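(* Let $[\beta,\lambda]$ be an interval in the dominance lattice $\mathcal{P}_n$ with atom set $\mathcal{A}$ such that $\bigvee\mathcal{A}=\lambda$, and let $\mathcal{A}$ carry the partial order $\unlhd$ defined by its special runs. Then $\lambda$ has an NBB base in $\mathcal{A}$ (with respect to the lattice $[\beta,\lambda]$ and the order $\unlhd$) if and only if there is no special run of length congruent to $1$ modulo $3$. If a base exists, then it is unique and equals $$B=\mathcal{A}\setminus\mathcal{S}_2 .$$
   Context: $\mathcal{P}_n$ is the lattice of partitions of the integer $n$ under dominance: for partitions $\lambda=(\lambda_1\ge\lambda_2\ge\cdots)$ and $\nu$ of $n$, $\lambda\ge\nu$ iff $\sum_{i=1}^k\lambda_i\ge\sum_{i=1}^k\nu_i$ for all $k$ (parts beyond the last are $0$). Fix $\beta=(\beta_1,\dots,\beta_r)\in\mathcal{P}_n$ with conventions $\beta_0=\infty$, $\beta_{k}=0$ for $k>r$. A wall is an interval $[i,j]\subseteq[1,r]$ of integers with $i<j$ and $\beta_{i-1}>\beta_i=\beta_j>\beta_{j+1}$. The elements covering $\beta$ in $\mathcal{P}_n$ are of two sorts: (i) if $1\le i<r$ and neither $i$ nor $i+1$ lies in a wall, the partition $\alpha$ agreeing with $\beta$ except $\alpha_i=\beta_i+1$, $\alpha_{i+1}=\beta_{i+1}-1$, denoted $i+1\to i$; (ii) if $[i,j]$ is a wall, the partition $\alpha$ agreeing with $\beta$ except $\alpha_i=\beta_i+1$, $\alpha_j=\beta_j-1$, denoted $j\to i$. The critical interval of such an $\alpha$ is the set of $k$ with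 $\sum_{l\le k}\alpha_l\ne\sum_{l\le k}\beta_l$; it is $\{i\}$ in case (i) and $[i,j-1]$ in case (ii). Distinct covers of $\beta$ have disjoint critical intervals. Let $\mathcal{A}$ be the set of atoms of $[\beta,\lambda]$ (covers of $\beta$ that are $\le\lambda$). An atom in $\mathcal{A}$ of the form $k+1\to k$ is special if $\beta_k=\beta_{k+1}+1$ and $\mathcal{A}$ also contains the atoms $k+2\to k+1$ and $k\to k-1$. Let $\mathcal{S}\subseteq\mathcal{A}$ be the set of special atoms. List $\mathcal{A}$ according to the left-to-right order of the critical intervals. A special run is a maximal sequence $\sigma_1,\dots,\sigma_q$ of consecutive elements of this list that are all special; its length is $q$. For a special run, let $\sigma_0=\tau$ and $\sigma_{q+1}=\tau'$ be the atoms immediately preceding and following it in the list (these exist and are not special). The partial order $\unlhd$ on $\mathcal{A}$ is the one whose strict relations are, for each special run $\sigma_1,\dots,\sigma_q$, $$\sigma_{3i+1}\lhd\sigma_{3i},\qquad \sigma_{3i+1}\lhd\sigma_{3i+2}\qquad\text{for all } i \text{ with } 1\le 3i+1\le q .$$ For $0\le j\le 2$, $\mathcal{S}_j$ is the set of elements of special runs $\sigma_1,\dots,\sigma_q$ (over all special runs) of the form $\sigma_{3i+j}$ for some $i$ (with index between $1$ and $q$), so $\mathcal{S}=\mathcal{S}_0\uplus\mathcal{S}_1\uplus\mathcal{S}_2$. For a finite lattice $L$ with order $\le$ and a partial order $\unlhd$ on its atom set $A(L)$, a nonempty $D\subseteq A(L)$ is bounded below (BB) if for every $d\in D$ there is $a\in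 A(L)$ with $a\lhd d$ and $a<\bigvee D$. A set $B\subseteq A(L)$ is NBB if it contains no BB subset; an NBB base of $x\in L$ is an NBB set $B$ with $\bigvee B=x$ (the empty join is the least element of $L$). Here $L=[\beta,\lambda]$ and $\bigvee$ is taken in $[\beta,\lambda]$. *)

(* Defs.v *)
From HB Require Import structures.
From mathcomp Require Import all_boot all_order zify.

Set Implicit Arguments.
Unset Strict Implicit.
Unset Printing Implicit Defensive.

Import Order.TTheory.

Section NBB.
Local Open Scope order_scope.
Context {d : Order.disp_t} {L : finTBLatticeType d}.

Definition atoms : {set L} :=
  [set a | (\bot < a) && [forall x : L, ~~ (\bot < x < a)]].

(* [tle] is the additional partial order on the atoms; only its values on
   pairs of atoms matter. *)
Variable tle : rel L.

Definition tlt : rel L := [rel a b | (a != b) && tle a b].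

Definition bounded_below (D : {set L}) : bool :=
  [&& D != set0, D \subset atoms &
      [forall e in D, exists a in atoms, tlt a e && (a < \join_(x in D) x)]].

Definition nbb (B : {set L}) : bool :=
  (B \subset atoms) &&
  [forall D : {set L}, (D \subset B) ==> ~~ bounded_below D].

Definition nbb_base (B : {set L}) (x : L) : bool :=
  nbb B && (\join_(b in B) b == x).

End NBB.

Arguments atoms {d} L.

Section IntervalLattice.
Local Open Scope order_scope.
Context {d : Order.disp_t} {L : finLatticeType d} {b t : L}.

Record itv_lattice (bt : b <= t) :=
  ItvLattice { itv_val :> L; _ : b <= itv_val <= t }.

Variable bt : b <= t.
Local Notation T := (itv_lattice bt).

HB.instance Definition _ := [isSub for @itv_val bt].
HB.instance Definition _ := [Finite of T by <:].

Fact itv_meet_closed : meet_closed (fun x : L => b <= x <= t).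
Proof.
move=> x y; rewrite -!topredE /= => /andP[bx xt] /andP[b_y yt].
by rewrite lexI bx b_y leIxl.
Qed.

Fact itv_join_closed : join_closed (fun x : L => b <= x <= t).
Proof.
move=> x y; rewrite -!topredE /= => /andP[bx xt] /andP[b_y yt].
by rewrite leUx xt yt lexUl.
Qed.

HB.instance Definition _ := Order.SubChoice_isSubLattice.Build d L
  (fun x : L => b <= x <= t) d T itv_meet_closed itv_join_closed.

Definition itv_bot : T := Sub b (introT andP (conj (lexx b) bt)).
Definition itv_top : T := Sub t (introT andP (conj bt (lexx t))).

Fact itv_le0x (x : T) : itv_bot <= x.
Proof. by rewrite leEsub; case/andP: (valP x). Qed.

Fact itv_lex1 (x : T) : x <= itv_top.
Proof. by rewrite leEsub; case/andP: (valP x). Qed.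

HB.instance Definition _ := Order.hasBottom.Build d T itv_le0x.
HB.instance Definition _ := Order.hasTop.Build d T itv_lex1.

End IntervalLattice.

(* A partition of n has at most n parts, each at most n; it is padded with
   zeros to a nonincreasing n-tuple. *)
Definition is_part n (s : n.-tuple 'I_n.+1) : bool :=
  sorted geq (map val s) && (sumn (map val s) == n).

Record intpart n := IntPart { parts :> n.-tuple 'I_n.+1; _ : is_part parts }.

HB.instance Definition _ n := [isSub for @parts n].
HB.instance Definition _ n := [Finite of intpart n by <:].

Section Parts.
Context {n : nat}.
Implicit Types x y : intpart n.

(* Parts are indexed from 1.  The convention that the part of index 0 is
   infinite is rendered by n.+1, which exceeds every part; parts beyond the
   last one are 0. *)
Definition part x (k : nat) : nat := nth 0 (n.+1 :: map val (parts x)) k.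

Definition plength x : nat := count (fun i => 0 < i) (map val (parts x)).

Definition psum x (k : nat) : nat := \sum_(1 <= l < k.+1) part x l.

(* Partial sums are equal to n from index n on. *)
Definition dominated : rel (intpart n) :=
  [rel x y | [forall k : 'I_n.+1, psum x k <= psum y k]].

End Parts.

Section DominanceLattice.
Variable n : nat.
Implicit Types x y z : intpart n.

Fact size_parts x : size (map val (parts x)) = n.
Proof. by rewrite size_map size_tuple. Qed.

Fact part_gt x k : n < k -> part x k = 0.
Proof. by move=> nk; rewrite /part nth_default //= size_parts. Qed.

Fact psumS x k : psum x k.+1 = psum x k + part x k.+1.
Proof. by rewrite /psum big_nat_recr. Qed.

Fact psum0 x : psum x 0 = 0.
Proof. by rewrite /psum big_geq. Qed.

Fact psumn x : psum x n = n.
Proof.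
have /andP[_ /eqP sn] : is_part (parts x) := valP x.
by rewrite /psum big_add1 /= -[RHS]sn sumnE [RHS](big_nth 0) size_parts.
Qed.

Fact part_noninc x k : part x k.+2 <= part x k.+1.
Proof.
have [kn|] := ltnP k.+1 n; last by move=> nk; rewrite part_gt.
have /andP[srt _] : is_part (parts x) := valP x.
by have /(_ k) := sortedP 0 srt; rewrite size_parts => /(_ kn).
Qed.

Fact psum_ge x k : n <= k -> psum x k = n.
Proof.
elim: k => [|k IH]; first by rewrite leqn0 psum0 => /eqP.
rewrite leq_eqVlt => /orP[/eqP <-|nk]; first exact: psumn.
by rewrite psumS IH // part_gt // addn0.
Qed.

Fact psum_le x k : psum x k <= n.
Proof.
have [kn|nk] := leqP k n; last by rewrite psum_ge // ltnW.
rewrite -[leqRHS](psumn x); apply: (homo_leq _ leq_trans) => // i.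
by rewrite psumS leq_addr.
Qed.

Fact psum_inj x y : (forall k, psum x k = psum y k) -> x = y.
Proof.
move=> e; apply/val_inj/val_inj/(inj_map val_inj).
apply: (@eq_from_nth _ 0); first by rewrite !size_parts.
move=> i _; have := e i.+1.
by rewrite !psumS e => /addnI.
Qed.

Fact dominatedP x y :
  reflect (forall k, psum x k <= psum y k) (dominated x y).
Proof.
apply: (iffP forallP) => [h k|h k]; last exact: h.
have [kn|nk] := leqP k n; first by have := h (inord k); rewrite inordK.
by rewrite !psum_ge // ltnW.
Qed.

Fact dominated_refl : reflexive (@dominated n).
Proof. by move=> x; apply/dominatedP. Qed.

Fact dominated_anti : antisymmetric (@dominated n).
Proof.
move=> x y /andP[/dominatedP xy /dominatedP yx]; apply: psum_inj => k.
by apply/eqP; rewrite eqn_leq xy yx.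
Qed.

Fact dominated_trans : transitive (@dominated n).
Proof.
move=> y x z /dominatedP xy /dominatedP yz; apply/dominatedP => k.
exact: leq_trans (xy k) (yz k).
Qed.

Fact dominance_display : Order.disp_t. Proof. exact: Order.Disp tt tt. Qed.

HB.instance Definition _ := Order.Le_isPOrder.Build dominance_display
  (intpart n) dominated_refl dominated_anti dominated_trans.

(* The meet has as partial sums the minima of those of its arguments, which are
   again concave. *)
Fact intpart_of_sums (f : nat -> nat) :
    f 0 = 0 -> f n = n ->
    (forall k, f k <= f k.+1) ->
    (forall k, f k + f k.+2 <= f k.+1 + f k.+1) ->
  {x : intpart n | forall k, k <= n -> psum x k = f k}.
Proof.
move=> f0 fn fM fC.
have fle k : k <= n -> f k <= n.
  by move=> kn; rewrite -[leqRHS]fn; apply: (homo_leq _ leq_trans).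
pose s := [tuple (inord (f i.+1 - f i) : 'I_n.+1) | i < n].
have sE : map val s = mkseq (fun i => f i.+1 - f i) n.
  apply: (@eq_from_nth _ 0); first by rewrite size_map size_tuple size_mkseq.
  rewrite size_map size_tuple => i lti.
  rewrite (nth_map ord0) ?size_tuple // nth_mkseq //.
  have -> : nth ord0 s i = tnth s (Ordinal lti) by rewrite (tnth_nth ord0).
  rewrite tnth_mktuple /= inordK //.
  by rewrite ltnS (leq_trans (leq_subr _ _)) // fle.
have sums k : \sum_(0 <= i < k) (f i.+1 - f i) = f k.
  by rewrite telescope_sumn_in // ?f0 ?subn0 // => i j; apply: fM.
have sP : is_part s.
  rewrite /is_part sE; apply/andP; split.
    apply/(sortedP 0) => i; rewrite size_mkseq => lti.
    rewrite !nth_mkseq //; last exact: ltnW.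
    rewrite /=; have := fM i; have := fM i.+1; have := fC i; lia.
  by rewrite sumnE big_map -[X in iota _ X]subn0 sums fn.
exists (Sub s sP) => k kn.
rewrite -[RHS]sums /psum big_add1 /= !big_nat; apply: eq_bigr => i /andP[_ ik].
by rewrite /part /= sE nth_mkseq // (leq_trans ik).
Qed.

Fact intpart_meet_ex x y :
  {z : intpart n | forall k, k <= n -> psum z k = minn (psum x k) (psum y k)}.
Proof.
apply: intpart_of_sums => [||k|k].
- by rewrite !psum0.
- by rewrite !psumn minnn.
- by rewrite !psumS; lia.
- rewrite !psumS; have := part_noninc x k; have := part_noninc y k; lia.
Qed.

Definition intpart_meet x y : intpart n := sval (intpart_meet_ex x y).

Fact intpart_lexI x y z :
  (x <= intpart_meet y z)%O = (x <= y)%O && (x <= z)%O.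
Proof.
have mE k : psum (intpart_meet y z) k = minn (psum y k) (psum z k).
  have [kn|nk] := leqP k n; first exact: (svalP (intpart_meet_ex y z)).
  by rewrite !psum_ge ?minnn // ltnW.
apply/dominatedP/andP => [h|[/dominatedP xy /dominatedP xz] k].
  by split; apply/dominatedP => k; have := h k; rewrite mE leq_min => /andP[].
by rewrite mE leq_min xy xz.
Qed.

HB.instance Definition _ := Order.POrder_isMeetSemilattice.Build
  dominance_display (intpart n) intpart_lexI.

Fact intpart_top_ex : {z : intpart n | forall x, (x <= z)%O}.
Proof.
have [||k|k|z zE] := @intpart_of_sums (fun k => if k is 0 then 0 else n).
- by [].
- by case: (n).
- by case: k.
- by case: k => [|k]; lia.
exists z => x; apply/forallP => -[k kn] /=; rewrite zE //.
by case: k kn => [|k] _; [rewrite psum0 | exact: psum_le].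
Qed.

Definition intpart_top : intpart n := sval intpart_top_ex.

HB.instance Definition _ := Order.hasTop.Build dominance_display
  (intpart n) (svalP intpart_top_ex).

Definition intpart_join x y : intpart n :=
  (\meet_(z : intpart n | (x <= z) && (y <= z)) z)%O.

Fact intpart_leUx x y z :
  (intpart_join x y <= z)%O = (x <= z)%O && (y <= z)%O.
Proof.
have xJ : (x <= intpart_join x y)%O by apply/meetsP => w /andP[].
have yJ : (y <= intpart_join x y)%O by apply/meetsP => w /andP[].
apply/idP/andP => [h|[xz yz]]; first by split; apply: le_trans h.
by apply: meets_inf; rewrite xz yz.
Qed.

HB.instance Definition _ := Order.POrder_isJoinSemilattice.Build
  dominance_display (intpart n) intpart_leUx.

End DominanceLattice.

Section Covers.
Context {n : nat}.
Implicit Types beta alpha : intpart n.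

Definition wall beta (i j : nat) : bool :=
  [&& 1 <= i, i < j, j <= plength beta,
      part beta i < part beta i.-1, part beta i == part beta j &
      part beta j.+1 < part beta j].

Definition in_wall beta (k : nat) : bool :=
  [exists i : 'I_n.+1, exists j : 'I_n.+1, wall beta i j && (i <= k <= j)].

Definition transfer beta (j i : nat) alpha : bool :=
  [forall k : 'I_n.+1, (0 < k) ==>
    (part alpha k == if k == i :> nat then (part beta k).+1
                     else if k == j :> nat then (part beta k).-1
                     else part beta k)].

(* alpha is the cover of beta denoted j -> i: an ordinary one, or that of a wall *)
Definition move beta (j i : nat) alpha : bool :=
  transfer beta j i alpha &&
  ([&& j == i.+1, 1 <= i, i < plength beta, ~~ in_wall beta i &
       ~~ in_wall beta i.+1]
   || wall beta i j).

Definition critical beta alpha : {set 'I_n.+1} :=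
  [set k : 'I_n.+1 | psum alpha k != psum beta k].

End Covers.

Section Runs.
Context {n : nat} {beta lambda : intpart n}.
Variable bl : (beta <= lambda)%O.
Local Notation L := (itv_lattice bl).
Local Notation A := (atoms L).

Definition special (a : L) : bool :=
  (a \in A) &&
  [exists k : 'I_n.+1,
    [&& move beta k.+1 k (val a), part beta k == (part beta k.+1).+1,
        [exists c in A, move beta k.+2 k.+1 (val c)] &
        [exists c in A, move beta k k.-1 (val c)]]].

Definition left_of (a c : L) : bool :=
  [forall k in critical beta (val a), forall l in critical beta (val c),
    k < l].

Definition atom_list : seq L :=
  sort (fun a c => (a == c) || left_of a c) (enum A).

(* The k-th atom, k = 1, ..., #|A|; for other k this is the bottom element,
   which is not an atom and so is not special. *)
Definition atom_at (k : nat) : L := nth \bot%O (\bot%O :: atom_list) k.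

(* The atoms of positions m+1, ..., m+q in the list form a special run
   sigma_1, ..., sigma_q; then sigma_i is atom_at (m + i) for 0 <= i <= q+1. *)
Definition special_run (m q : nat) : bool :=
  [&& 0 < q, all (fun i => special (atom_at (m + i))) (iota 1 q),
      ~~ special (atom_at m) & ~~ special (atom_at (m + q.+1))].

Definition run_lt (a c : L) : bool :=
  [exists m : 'I_#|A|.+1, exists q : 'I_#|A|.+1, exists i : 'I_#|A|.+1,
    [&& special_run m q, 3 * i + 1 <= q, a == atom_at (m + (3 * i + 1)) &
        (c == atom_at (m + 3 * i)) || (c == atom_at (m + (3 * i + 2)))]].

Definition run_le : rel L := [rel a c | (a == c) || run_lt a c].

Definition run_class (j : nat) : {set L} :=
  [set a | [exists m : 'I_#|A|.+1, exists q : 'I_#|A|.+1,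
            exists i : 'I_#|A|.+1,
    [&& special_run m q, 1 <= 3 * i + j <= q &
        a == atom_at (m + (3 * i + j))]]].

End Runs.

Arguments run_lt {n beta lambda} bl.
Arguments run_le {n beta lambda} bl.
Arguments run_class {n beta lambda} bl j.

(* Main.v *)
Require Import Defs.
From mathcomp Require Import all_boot all_order zify.

(** Partial sums turn partitions of [n] into nondecreasing concave sequences
    from [0] to [n], and dominance into the pointwise order.  An atom of
    [[beta, lambda]] raises the partial sums of [beta] by 1 exactly on its
    critical interval ([atom_move], [move_psum]), and critical intervals of
    distinct atoms are disjoint ([raised_inj]), so that atoms are ordered and
    identified by the left ends [pos] of these intervals.

    Everything then rests on which atoms lie below the join of a set [D] of
    atoms ([le_join_at]): the members of [D], and the special atoms both of
    whose neighbours in the list belong to [D].  A special atom is at a place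
    [k] where the slope of the partial sums drops by 1, and its neighbours are
    at [k-1] and [k+1]; raising the sums at [k-1] and [k+1] destroys concavity
    at [k] unless the sum at [k] is raised too ([concave_fill]).  For the
    converse, an atom [a] that is not forced in this way avoids the join
    because all sums of [beta] away from a short interval around [a] can be
    raised by 1 at once without losing concavity ([raise_outside]), and the
    interval can be chosen to meet no critical interval of a member of [D].

    The rest is combinatorics of the list.  The strict relations of the order
    go from the elements of index 1 modulo 3 of a run to their two neighbours,
    and no relations can be chained.  Hence a bounded below set contains both
    neighbours [sigma_{3i}] and [sigma_{3i+2}] of some [sigma_{3i+1}], while
    such a pair is itself bounded below, because its join is above
    [sigma_{3i+1}]; so a set is NBB iff it contains no such pair
    ([nbb_pairs]).  A base must have all atoms below its join.  So it contains
    the atoms that are not special, in particular [sigma_0]; and going along a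
    run ([base_on_run]), if [sigma_{3i}] is in the base, then so is
    [sigma_{3i+1}], as it cannot be forced by its neighbours; then
    [sigma_{3i+2}] is not, hence it must be special and forced by its
    neighbours, so that [sigma_{3i+3}] is again in the base.  This determines
    the base, and it breaks down exactly when [sigma_{3i+2}] is the atom that
    follows the run, that is, when the length of the run is [3i+1].  If that
    never happens, the same two criteria show that the resulting set is a
    base. *)

Set Implicit Arguments.
Unset Strict Implicit.
Unset Printing Implicit Defensive.

Import Order.TTheory.

(** * Partitions and their partial sums *)

Section Partitions.
Context {n : nat}.
Implicit Types x y beta alpha : intpart n.

Lemma le_psumP x y :
  reflect (forall k, psum x k <= psum y k) (x <= y)%O.
Proof. exact: dominatedP. Qed.

Lemma part_gt0 x k : 0 < k -> (0 < part x k) = (k <= plength x).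
Proof.
case: k => // k _; rewrite /part /plength /=.
have /andP[srt _] : is_part (parts x) := valP x.
elim: (map val _) k srt => [|v s IH] k /=; first by rewrite nth_nil.
case: (posnP v) => [->|v0] sv; last first.
  by case: k => [|k] //=; rewrite (IH _ (path_sorted sv)) add1n.
have /allP s0 : all (geq 0) s.
  by apply: order_path_min sv => a b c /= ? ?; lia.
have c0 : count (fun i => 0 < i) s = 0.
  by apply/eqP; rewrite eqn0Ngt -has_count; apply/hasPn => w /s0 /=; lia.
by case: k => [|k]; rewrite ?c0 //= (IH _ (path_sorted sv)) c0.
Qed.

Lemma plength_le x : plength x <= n.
Proof. by rewrite (leq_trans (count_size _ _)) // size_parts. Qed.

Lemma part_le x k l : k <= l -> part x l <= part x k.
Proof.
have step i : part x i.+1 <= part x i.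
  case: i => [|i]; last exact: part_noninc.
  by have := psum_le x 1; rewrite psumS psum0; apply: leqW.
elim: l => [|l IH]; first by rewrite leqn0 => /eqP->.
by rewrite leq_eqVlt => /predU1P[->//|/IH]; apply: leq_trans.
Qed.

Lemma part1_lt0 x : part x 1 < part x 0.
Proof. by have := psum_le x 1; rewrite psumS psum0. Qed.

(** Partial sums of [x] that are raised by 1 on a set [V] of indices can lose
    concavity only at an index outside [V] with a neighbour in [V]; the
    condition says that the slope drops enough there. *)
Lemma raise_psum x (V : nat -> bool) :
    (forall k, V k -> 0 < k < plength x) ->
    (forall k, 0 < k < plength x -> ~~ V k ->
       V k.-1 + V k.+1 + part x k.+1 <= part x k) ->
  exists y, forall k, psum y k = psum x k + V k.
Proof.
move=> Vr Vc; have r_n := plength_le x.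
have V0 k : plength x <= k -> V k = false.
  by move=> rk; apply/negP => /Vr; lia.
have pr := part_gt0 x.
have [||k|k|y yE] := @intpart_of_sums n (fun k => psum x k + V k).
- by rewrite psum0; case: (V 0) (Vr 0) => // /(_ isT).
- by rewrite psumn V0 // addn0.
- rewrite psumS; case Vk: (V k) => /=; last by lia.
  by have := pr k.+1 isT; have := Vr _ Vk; lia.
- rewrite !psumS; have := @part_le x k.+1 k.+2 (leqnSn _).
  case Vk: (V k.+1) => /=; first by case: (V k); case: (V k.+2); lia.
  have [kr|rk] := ltnP k.+1 (plength x).
    by have := Vc k.+1 kr; rewrite Vk /= => /(_ isT); lia.
  rewrite (V0 k.+2); last by lia.
  case V1: (V k) => /=; last by lia.
  have := Vr _ V1; have := pr k.+1 isT; have := pr k.+2 isT; lia.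
exists y => k; have [|nk] := leqP k n; first exact: yE.
by rewrite V0 ?addn0 ?psum_ge //; lia.
Qed.

(** All sums can be raised at once except on an interval [[u, w]]: inside it
    nothing changes, and at each end the slope has to drop by the number of
    raised neighbours, which is 2 when the interval is a single index.  The
    value [u = 0] is allowed; the convention that part 0 is infinite makes the
    condition at this end hold. *)
Lemma raise_outside x u w :
    u <= w -> part x w.+1 < part x w ->
    (if u == w then part x u.+1 + 2 <= part x u else part x u.+1 < part x u) ->
  exists y, forall k,
    psum y k = psum x k + ((0 < k < plength x) && ~~ (u <= k <= w)).
Proof.
move=> uw hw hu; apply: raise_psum => [k /andP[]//|k kr].
rewrite kr /= negbK => /andP[uk kw].
have := part_le x (leqnSn k).
have [ek|uk'] := eqVneq k u; have [ek'|kw'] := eqVneq k w.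
- by subst u w; rewrite eqxx in hu; lia.
- by subst k; move: hu; rewrite (negPf kw'); lia.
- by subst k; lia.
- by lia.
Qed.

(** Concavity of [psum y] at [k] gives
    [2 * psum y k >= psum y k.-1 + psum y k.+1 >= 2 * psum x k + 1]. *)
Lemma concave_fill x y k :
    0 < k -> part x k = (part x k.+1).+1 ->
    psum x k.-1 < psum y k.-1 -> psum x k.+1 < psum y k.+1 ->
  psum x k < psum y k.
Proof.
case: k => // k _; have := part_le y (leqnSn k.+1); rewrite /= !psumS; lia.
Qed.

(** * Walls and moves *)

Lemma wall_flat beta i j :
  wall beta i j -> forall k, i <= k <= j -> part beta k = part beta i.
Proof.
move=> /and5P[i1 ij jr hi /andP[/eqP e _]] k /andP[ik kj].
by have := part_le beta ik; have := part_le beta kj; lia.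
Qed.

Lemma in_wallP beta k :
  reflect (exists i j, wall beta i j /\ i <= k <= j) (in_wall beta k).
Proof.
apply: (iffP existsP) => [[i /existsP[j /andP[w h]]]|[i [j [w h]]]].
  by exists i, j.
have /and5P[i1 ij jr hi /andP[/eqP e _]] := w.
have jn := leq_trans jr (plength_le beta).
have hj : j < n.+1 by [].
have hi' : i < n.+1 by lia.
by exists (Ordinal hi'); apply/existsP; exists (Ordinal hj); rewrite /= w h.
Qed.

(** The wall is the set of all indices with the same part as [k]. *)
Lemma flat_wall beta k :
    0 < k < plength beta -> part beta k = part beta k.+1 ->
  exists i j, wall beta i j /\ i <= k < j.
Proof.
move=> kr e.
pose P := fun i => (0 < i) && (part beta i == part beta k).
pose Q := fun j => (0 < j) && (part beta j == part beta k).
have exP : exists i, P i by exists k; rewrite /P eqxx; case/andP: kr => ->.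
have exQ : exists j, Q j by exists k; rewrite /Q eqxx; case/andP: kr => ->.
have ubQ j : Q j -> j <= plength beta.
  case/andP => j0 /eqP ej; rewrite -part_gt0 // ej part_gt0 //; lia.
case: (ex_minnP exP) => i /andP[i0 /eqP ei] mi.
case: (ex_maxnP exQ ubQ) => j Qj mj.
have jr := ubQ _ Qj; case/andP: Qj => j0 /eqP ej.
have ik : i <= k by apply: mi; rewrite /P eqxx; lia.
have kj : k < j by apply: mj; rewrite /Q e eqxx.
exists i, j; split; last by rewrite ik.
apply/and5P; split=> //; first by lia.
  have [i1|i1] := eqVneq i 1.
    by rewrite i1 part1_lt0.
  have := mi i.-1; have := part_le beta (leq_pred i); rewrite /P; lia.
rewrite ei ej eqxx /=.
have := mj j.+1; have := part_le beta (leqnSn j); rewrite /Q; lia.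
Qed.

Lemma unwalled_drop beta k :
    0 < k <= plength beta -> ~~ in_wall beta k ->
  part beta k < part beta k.-1 /\ part beta k.+1 < part beta k.
Proof.
move=> kr nk; split; rewrite ltn_neqAle part_le ?leq_pred ?andbT //.
  have [->|k1] := eqVneq k 1; first by rewrite neq_ltn part1_lt0.
  apply/eqP => e; have [||i [j [w h]]] := @flat_wall beta k.-1; first by lia.
    by rewrite prednK //; lia.
  by case/in_wallP: nk; exists i, j; split => //; lia.
apply/eqP => e; have [k1|k1] := ltnP k (plength beta).
  have [|i [j [w h]]] := flat_wall _ (esym e); first by lia.
  by case/in_wallP: nk; exists i, j; split => //; lia.
have := part_gt0 beta (k := k); have := part_gt0 beta (k := k.+1); lia.
Qed.

Lemma move_bounds beta j i alpha :
  move beta j i alpha -> [/\ 0 < i, i < j & j <= plength beta].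
Proof.
by case/andP => _ /orP[/and5P[/eqP -> i0 ir _ _]|/and5P[i1 ij jr _ _]].
Qed.

Lemma move_psum beta j i alpha :
  move beta j i alpha ->
  forall k, psum alpha k = psum beta k + (i <= k < j).
Proof.
move=> m; have [i0 ij jr] := move_bounds m.
case/andP: m => /forallP t _.
have pE k : 0 < k -> part alpha k = if k == i then (part beta k).+1
                     else if k == j then (part beta k).-1 else part beta k.
  move=> k0; have [kn|nk] := leqP k n.
    by have := t (inord k); rewrite inordK // k0 => /eqP.
  by have := plength_le beta; rewrite !part_gt //; do 2 (case: ifP; try lia).
have bj : 0 < part beta j by rewrite part_gt0 //; lia.
elim=> [|k IH]; first by rewrite !psum0; lia.
rewrite !psumS IH pE //; have [ek|nk1] := eqVneq; first by lia.
have [ej|nk2] := eqVneq; last by lia.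
by rewrite ej; lia.
Qed.

Lemma raise_move beta j i alpha :
    [&& j == i.+1, 1 <= i, i < plength beta, ~~ in_wall beta i &
       ~~ in_wall beta i.+1] || wall beta i j ->
    (forall k, psum alpha k = psum beta k + (i <= k < j)) ->
  move beta j i alpha.
Proof.
move=> h pE; rewrite /move h andbT; apply/forallP => -[k kn] /=.
apply/implyP; case: k kn => // k kn _.
have [ij [i0 jr]] : i < j /\ 0 < i /\ j <= plength beta.
  by case/orP: h => [/and5P[/eqP -> ? ? _ _]|/and5P[? ? ? _ _]]; lia.
have bj : 0 < part beta j by rewrite part_gt0 //; lia.
have := pE k.+1; rewrite !psumS pE => e; apply/eqP.
have [ek|nk1] := eqVneq; first by lia.
have [ej|nk2] := eqVneq; last by lia.
by move: e; rewrite ej; lia.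
Qed.

(** Two walls that share an index coincide, and an ordinary move does not
    involve any index of a wall; so the critical intervals of distinct moves
    are disjoint. *)
Lemma move_overlap beta j i alpha j' i' alpha' k :
    move beta j i alpha -> move beta j' i' alpha' ->
    i <= k < j -> i' <= k < j' ->
  i = i' /\ j = j'.
Proof.
have W a b c (w : wall beta a b) : a <= c < b -> in_wall beta c.
  by move=> h; apply/in_wallP; exists a, b; split => //; lia.
have WW a b a' b' : wall beta a b -> wall beta a' b' ->
    a <= k < b -> a' <= k < b' -> a <= a' /\ b <= b'.
  move=> w w' h h'.
  have fl := wall_flat w; have fl' := wall_flat w'.
  have /and5P[? ? ? hi /andP[_ hj]] := w.
  have /and5P[? ? ? hi' /andP[/eqP e' hj']] := w'.
  have ek := fl k; have ek' := fl' k.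
  split; rewrite leqNgt; apply/negP => lt.
    have := fl' a; have := fl' a.-1; lia.
  have := fl b'; have := fl b'.+1; lia.
case/andP => _ /orP[/and5P[/eqP -> _ _ n1 n2]|w];
  case/andP => _ /orP[/and5P[/eqP -> _ _ n1' n2']|w'] h h'.
- lia.
- have ek : i = k by lia.
  by subst k; rewrite (W _ _ _ w' h') in n1.
- have ek : i' = k by lia.
  by subst k; rewrite (W _ _ _ w h) in n1'.
- by have := WW _ _ _ _ w w' h h'; have := WW _ _ _ _ w' w h' h; lia.
Qed.

(** The critical interval of a wall [[i, j]] is [[i, j-1]].  The indices
    [i-1] and [j] next to it lie in no critical interval at all, since a move
    that raises the sum at [l] involves both [l] and [l+1], of which exactly
    one would be in the wall. *)
Lemma wall_isolated beta i j j' i' alpha l :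
    wall beta i j -> move beta j' i' alpha -> i' <= l < j' -> i.-1 <= l <= j ->
  i <= l < j.
Proof.
move=> w m h hl; have fl := wall_flat w.
have W s : i <= s <= j -> in_wall beta s.
  by move=> hs; apply/in_wallP; exists i, j.
have /and5P[i0 ij _ hi /andP[_ hj]] := w.
apply/idPn => nl; have [e|e] : l = j \/ l.+1 = i by lia.
  case/andP: m => _ /orP[/and5P[/eqP ej' _ ir' nw nw1]|w'].
    by case/negP: nw; apply: W; lia.
  have fl' := wall_flat w'; have := fl' l; have := fl' l.+1.
  by rewrite e; lia.
case/andP: m => _ /orP[/and5P[/eqP ej' _ ir' nw nw1]|w'].
  by case/negP: nw1; apply: W; lia.
have fl' := wall_flat w'; have := fl' l; have := fl' l.+1.
by move: hi; rewrite -e /=; lia.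
Qed.

(** While the parts of [beta] are constant, [psum x] cannot come back down to
    [psum beta]: the parts of [x] would be smaller from that index on, and the
    sums of [x] would fall below those of [beta]. *)
Lemma wall_move_below beta x i j :
    (beta <= x)%O -> wall beta i j -> psum beta i < psum x i ->
  exists2 alpha, move beta j i alpha & (alpha <= x)%O.
Proof.
move=> /le_psumP bx w lt; have fl := wall_flat w.
have /and5P[i0 ij jr hi /andP[/eqP e hj]] := w.
have above k : i <= k < j -> psum beta k < psum x k.
  elim: k => [|k IH] h; first by lia.
  have [ek|nk] := eqVneq i k.+1; first by rewrite -ek.
  rewrite ltnNge; apply/negP => le.
  have {}IH := IH ltac:(lia).
  have := bx k.+2; have := @part_le x k.+1 k.+2 (leqnSn _).
  have := fl k.+1; have := fl k.+2; move: le; rewrite !psumS; lia.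
have [||alpha aE] := @raise_psum beta (fun k => i <= k < j).
- by lia.
- move=> k kr nk; have := part_le beta (leqnSn k).
  have [e1|n1] := eqVneq i k.+1.
    by move: hi; rewrite e1 /=; lia.
  have [e2|n2] := eqVneq j k; last by lia.
  by rewrite -e2; lia.
exists alpha; first by apply: raise_move => //; rewrite w orbT.
apply/le_psumP => k; rewrite aE.
have := above k; have := bx k.
by case: (i <= k < j) => /=; [move=> _ /(_ isT)|]; lia.
Qed.

Lemma psum_plength beta k : plength beta <= k -> psum beta k = n.
Proof.
move=> rk; suff const m : psum beta (k + m) = psum beta k.
  by rewrite -(const n) psum_ge ?leq_addl.
elim: m => [|m IH]; first by rewrite addn0.
by rewrite addnS psumS IH; have := part_gt0 beta (ltn0Sn (k + m)); lia.
Qed.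

(** Every partition above [beta] is above a cover of the two known sorts.
    Look at the first index [k] where the sums differ: there [x] has a larger
    part than [beta], so that [k] is not inside or at the end of a wall of
    [beta].  If a wall starts at [k] or at [k+1], its move works; otherwise the
    ordinary move at [k] does. *)
Lemma move_below beta x :
    (beta < x)%O ->
  exists j i alpha, move beta j i alpha /\ (alpha <= x)%O.
Proof.
rewrite lt_neqAle => /andP[nbx bx]; have /le_psumP bxP := bx.
have ex : exists k, psum beta k < psum x k.
  have : ~~ dominated x beta.
    apply: contra nbx => xb; apply/eqP/le_anti/andP; split; [exact: bx|exact: xb].
  by case/forallPn => k; rewrite -ltnNge; exists k.
case: (ex_minnP ex) => k kx mk.
have k0 : 0 < k by rewrite lt0n; apply/eqP => e; move: kx; rewrite e !psum0.
have eqb m : m < k -> psum x m = psum beta m.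
  by move=> mk'; have := bxP m; have := mk m; lia.
have kr : k < plength beta.
  rewrite ltnNge; apply/negP => /psum_plength e.
  by have := psum_le x k; lia.
have xk : part beta k < part x k.
  by move: kx; rewrite -(prednK k0) !psumS eqb ?prednK //; lia.
have down : part beta k < part beta k.-1.
  case: k k0 xk eqb {kx mk kr} => [//|[|k]] _ xk eqb.
    exact: part1_lt0.
  have := eqb k.+1 (leqnn _); rewrite !psumS eqb //.
  by have := part_le x (leqnSn k.+1); rewrite /=; lia.
have start i j : wall beta i j -> i <= k <= j -> i = k.
  move=> w h; have fl := wall_flat w.
  by have := fl k; have := fl k.-1; lia.
have [e|ne] := eqVneq (part beta k) (part beta k.+1).
  have [|i [j [w h]]] := flat_wall _ e; first by lia.
  have ik : i = k by apply: start w _; lia.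
  rewrite ik in w; have [alpha m le] := wall_move_below bx w kx.
  by exists j, k, alpha.
have nk : ~~ in_wall beta k.
  apply/negP => /in_wallP[i [j [w h]]]; have fl := wall_flat w.
  have ik := start _ _ w h; have /and5P[_ ij _ _ _] := w.
  by have := fl k; have := fl k.+1; lia.
have [/in_wallP[i [j [w h]]]|nk1] := boolP (in_wall beta k.+1).
  have fl := wall_flat w; have /and5P[_ ij _ _ _] := w.
  have ik : i = k.+1 by have := fl k; have := fl k.+1; lia.
  rewrite ik in w ij fl.
  have lt : psum beta k.+1 < psum x k.+1.
    (* Otherwise x has at k+1, hence at k+2, a smaller part than beta. *)
    rewrite ltnNge; apply/negP => le; have := bxP k.+2.
    have := part_le x (leqnSn k.+1); have := fl k.+2; move: le.
    by rewrite !psumS; lia.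
  have [alpha m le] := wall_move_below bx w lt.
  by exists j, k.+1, alpha.
have [||alpha aE] := @raise_psum beta (fun m => k <= m < k.+1).
- by lia.
- move=> m mr nm; have := part_le beta (leqnSn m).
  have [e1|n1] := eqVneq k m.+1; first by move: down; rewrite e1 /=; lia.
  have [e2|n2] := eqVneq m k.+1; last by lia.
  have [e3|n3] := eqVneq (part beta m) (part beta m.+1); last by lia.
  have [i [j [w h]]] := flat_wall mr e3.
  by case/in_wallP: nk1; exists i, j; split => //; lia.
exists k.+1, k, alpha; split.
  by apply: raise_move => //; rewrite eqxx k0 kr nk nk1.
apply/le_psumP => m; rewrite aE.
by have [e|n1] := eqVneq m k; [subst m|have := bxP m]; lia.
Qed.

End Partitions.

(** * Atoms of the interval *)

Section Atoms.
Context {n : nat} {beta lambda : intpart n}.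
Variable bl : (beta <= lambda)%O.
Local Notation L := (itv_lattice bl).
Local Notation A := (atoms L).
Implicit Types (a c : L) (B D : {set L}).

Lemma itv_le_psumP a c :
  reflect (forall k, psum (val a) k <= psum (val c) k) (a <= c)%O.
Proof. by rewrite -Order.le_val; apply: le_psumP. Qed.

Lemma itv_ge a k : psum beta k <= psum (val a) k.
Proof. by have /andP[/le_psumP] := valP a. Qed.

Lemma atom_move a : a \in A -> exists j i, move beta j i (val a).
Proof.
rewrite inE => /andP[a0 /forallP amin].
have /move_below[j [i [alpha [m le]]]] : (beta < val a)%O.
  by move: a0; rewrite -lt_val.
have [i0 ij jr] := move_bounds m; have aE := move_psum m.
have /andP[_ al] := valP a.
have ba : (beta <= alpha)%O by apply/le_psumP => k; rewrite aE leq_addr.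
pose x : L := Sub alpha (introT andP (conj ba (le_trans le al))).
have bx : (\bot < x)%O.
  rewrite -lt_val lt_neqAle /= ba andbT; apply/eqP => e.
  by have := aE i; rewrite -e leqnn ij; lia.
exists j, i; have -> // : val a = alpha.
have := amin x; rewrite bx /= lt_neqAle -Order.le_val [val x]/= le andbT negbK.
by move=> /eqP <-.
Qed.

Definition raised a k := psum beta k < psum (val a) k.

(** The left end of the critical interval of [a], if [a] is an atom. *)
Definition pos a := find (raised a) (iota 0 n.+1).

Lemma raised_move a j i : move beta j i (val a) -> raised a =1 (fun k => i <= k < j).
Proof. by move=> m k; rewrite /raised (move_psum m); lia. Qed.

Lemma pos_move a j i : move beta j i (val a) -> pos a = i.
Proof.
move=> m; have [i0 ij jr] := move_bounds m; have rE := raised_move m.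
have i_n : i < n.+1 by have := plength_le beta; lia.
have h : has (raised a) (iota 0 n.+1).
  by apply/hasP; exists i; rewrite ?mem_iota // rE leqnn ij.
have := nth_find 0 h; rewrite has_find size_iota in h.
rewrite nth_iota // add0n -/(pos a) rE => /andP[le _]; apply/eqP.
rewrite eqn_leq le andbT leqNgt; apply/negP => lt.
by have := before_find 0 lt; rewrite nth_iota // add0n rE leqnn ij.
Qed.

Lemma atom_psum a : a \in A -> forall k, psum (val a) k = psum beta k + raised a k.
Proof.
by case/atom_move => j [i m] k; rewrite (raised_move m) (move_psum m).
Qed.

Lemma raised_pos a : a \in A -> raised a (pos a).
Proof.
case/atom_move => j [i m]; have [_ ij _] := move_bounds m.
by rewrite (pos_move m) (raised_move m) leqnn.
Qed.

Lemma raised_inj a c k : a \in A -> c \in A -> raised a k -> raised c k -> a = c.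
Proof.
move=> aA cA; have [j [i m]] := atom_move aA; have [j' [i' m']] := atom_move cA.
rewrite (raised_move m) (raised_move m') => h h'.
have [ei ej] := move_overlap m m' h h'.
apply/val_inj/psum_inj => l; rewrite !atom_psum //.
by rewrite (raised_move m) (raised_move m') ei ej.
Qed.

Lemma pos_inj : {in A &, injective pos}.
Proof.
move=> a c aA cA e; apply: (@raised_inj _ _ (pos a)) => //.
  exact: raised_pos.
by rewrite e raised_pos.
Qed.

Lemma move_unwalled j i alpha k :
    move beta j i alpha -> i <= k < j ->
    ~~ in_wall beta k \/ ~~ in_wall beta k.+1 ->
  i = k /\ j = k.+1.
Proof.
case/andP => _ /orP[/and5P[/eqP -> i0 ir nw nw1]|w] h; first by lia.
by case=> /in_wallP[]; exists i, j; split => //; lia.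
Qed.

(** * Atoms below the join of a set of atoms *)

(** The sums of [beta] raised everywhere except on [[u, w]] give a partition
    [y] above all members of [D]; it may exceed [lambda], so the upper bound
    within the interval is the meet of [y] and [lambda]. *)
Lemma join_avoid (D : {set L}) u w a k :
    D \subset A -> u <= w -> part beta w.+1 < part beta w ->
    (if u == w then part beta u.+1 + 2 <= part beta u
     else part beta u.+1 < part beta u) ->
    (forall d l, d \in D -> u <= l <= w -> ~~ raised d l) ->
    u <= k <= w -> raised a k ->
  ~~ (a <= \join_(d in D) d)%O.
Proof.
move=> /subsetP DA uw hw hu Duw kuw ak; apply/negP => aJ.
have [y yE] := raise_outside uw hw hu.
have Dy d : d \in D -> (val d <= y)%O.
  move=> dD; apply/le_psumP => l; rewrite atom_psum ?DA // yE.
  have [j [i m]] := atom_move (DA d dD); have [i0 ij jr] := move_bounds m.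
  have := Duw d l dD; rewrite (raised_move m).
  by case: (u <= l <= w) => [/(_ isT)|_] /=; lia.
have by_ : (beta <= y)%O by apply/le_psumP => l; rewrite yE leq_addr.
have xP : (beta <= Order.meet y lambda <= lambda)%O.
  by rewrite lexI by_ bl leIr.
pose x : L := Sub (Order.meet y lambda) xP.
have Jx : (\join_(d in D) d <= x)%O.
  apply/joinsP => d dD; rewrite -Order.le_val /= lexI Dy //=.
  by have /andP[] := valP d.
have : (val a <= y)%O.
  have := le_trans aJ Jx; rewrite -Order.le_val /= => /le_trans; apply; exact: leIl.
move/le_psumP => /(_ k); rewrite yE kuw andbF addn0 leqNgt.
by rewrite [_ < _]ak.
Qed.

Lemma specialP a :
  reflect (exists k c c', [/\ a \in A, c \in A & c' \in A] /\
     [/\ move beta k.+1 k (val a), part beta k = (part beta k.+1).+1,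
         move beta k k.-1 (val c) & move beta k.+2 k.+1 (val c')])
    (special a).
Proof.
apply: (iffP andP).
  case=> aA /existsP[k /and4P[m /eqP e ex' ex]].
  have /existsP[c' /andP[c'A m']] := ex'; have /existsP[c /andP[cA mc]] := ex.
  by exists k, c, c'; do !split.
case=> k [c [c' [[aA cA c'A] [m e mc m']]]]; split => //.
have [? ? kr] := move_bounds m; have kn : k < n.+1.
  by have := plength_le beta; lia.
apply/existsP; exists (Ordinal kn); rewrite /= m e eqxx /=.
by apply/andP; split; apply/existsP; [exists c'|exists c]; apply/andP.
Qed.

Lemma special_atom a : special a -> a \in A. Proof. by case/andP. Qed.

Lemma special_nbrs a : special a ->
  exists c c', [/\ c \in A, c' \in A, (pos c).+1 = pos a & pos c' = (pos a).+1].
Proof.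
case/specialP => k [c [c' [[aA cA c'A] [m e mc m']]]].
exists c, c'; rewrite (pos_move m) (pos_move mc) (pos_move m'); split => //.
by have [] := move_bounds mc; lia.
Qed.

Lemma raised_le a x k : (a <= x)%O -> raised a k -> raised x k.
Proof. by move=> /itv_le_psumP ax ak; apply: leq_trans ak (ax k). Qed.

Lemma le_raised a x : a \in A -> (forall k, raised a k -> raised x k) -> (a <= x)%O.
Proof.
move=> aA h; apply/itv_le_psumP => k; rewrite atom_psum //.
have := h k; case: (raised a k) => [/(_ isT)|_]; first by rewrite addn1.
by rewrite addn0 itv_ge.
Qed.

Lemma le_join_nbrs D a c c' : D \subset A -> c \in D -> c' \in D -> special a ->
  (pos c).+1 = pos a -> pos c' = (pos a).+1 -> (a <= \join_(d in D) d)%O.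
Proof.
move=> /subsetP DA cD c'D /specialP[k [b [b' [[aA bA b'A] [m e mb mb']]]]].
rewrite (pos_move m) => pc pc'.
have cb : c = b.
  by apply: pos_inj (DA _ cD) bA _; rewrite (pos_move mb) -pc.
have cb' : c' = b' by apply: pos_inj (DA _ c'D) b'A _; rewrite (pos_move mb').
apply: le_raised => // l; rewrite (raised_move m) ltnS -eqn_leq => /eqP <-.
have [k0 _ _] := move_bounds m.
have lo : raised c k.-1 by rewrite cb (raised_move mb) leqnn prednK /=.
have hi : raised c' k.+1 by rewrite cb' (raised_move mb') leqnn /=.
by apply: concave_fill; rewrite // -/(raised _ _);
  [apply: raised_le lo|apply: raised_le hi]; apply: joins_sup.
Qed.

(** Suppose that [a] is not in [D].  The interval [[u, w]] around [a] to which
    [join_avoid] applies depends on [a].  For a wall [[i, j]] it is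
    [[i-1, j]], which meets no other critical interval.  For an ordinary move
    at [i] it is [[i, i]] if the parts at [i] and [i+1] differ by at least 2;
    otherwise [[i, i+1]] and [[i-1, i]] are suitable, and since [a] is below
    the join, each of them meets the critical interval of a member of [D],
    which has to be the move at [i+1], resp. [i-1]. *)
Lemma le_join_inv D a : D \subset A -> a \in A -> (a <= \join_(d in D) d)%O ->
  a \in D \/ special a /\ exists c c', [/\ c \in D, c' \in D,
     (pos c).+1 = pos a & pos c' = (pos a).+1].
Proof.
move=> DA aA aJ; have /subsetP DAP := DA.
have [aD|aD] := boolP (a \in D); [by left|right].
have [j [i m]] := atom_move aA; have [i0 ij jr] := move_bounds m.
have ai : raised a i by rewrite (raised_move m) leqnn ij.
(* As a is below the join, no interval around it that satisfies the hypotheses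
   of join_avoid is free of critical intervals of D. *)
have away u w : u <= i <= w -> part beta w.+1 < part beta w ->
    (if u == w then part beta u.+1 + 2 <= part beta u
     else part beta u.+1 < part beta u) ->
    exists2 d, d \in D & exists l, [/\ u <= l <= w, ~~ raised a l & raised d l].
  move=> uiw hw hu; case/andP: (uiw) => ui iw.
  have [|none] := boolP [exists d in D, exists l : 'I_w.+1, (u <= l) && raised d l].
    case/exists_inP => d dD /existsP[[l lw] /andP[/= ul dl]].
    exists d => //; exists l; split; rewrite ?ul //; apply: contra aD => al.
    by rewrite (raised_inj aA (DAP _ dD) al dl).
  suff untouched d l : d \in D -> u <= l <= w -> ~~ raised d l.
    by have := join_avoid DA (leq_trans ui iw) hw hu untouched uiw ai; rewrite aJ.
  move=> dD /andP[ul lw]; apply: contra none => dl; apply/exists_inP.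
  by exists d => //; apply/existsP; exists (Ordinal (lw : l < w.+1)); rewrite /= ul.
clear DA aJ.
case/andP: (m) => _ /orP[/and5P[/eqP ej _ ir nw nw1]|w]; last first.
  have /and5P[_ _ _ hi /andP[_ hj]] := w.
  have [|||d dD [l [hl nl dl]]] := away i.-1 j.
  - by rewrite leq_pred ltnW.
  - by [].
  - by rewrite prednK // ltn_eqF // (leq_ltn_trans (leq_pred i)).
  have [j' [i' m']] := atom_move (DAP _ dD); rewrite (raised_move m') in dl.
  by case/negP: nl; rewrite (raised_move m) (wall_isolated w m' dl hl).
subst j; have {}ai l : raised a l = (l == i).
  by rewrite (raised_move m) ltnS -eqn_leq eq_sym.
have [|si si'] := @unwalled_drop _ beta i _ nw; first by rewrite i0 ltnW.
have [|_ si1] := @unwalled_drop _ beta i.+1 _ nw1; first by [].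
have e : part beta i = (part beta i.+1).+1.
  apply/eqP; rewrite eqn_leq si' andbT leqNgt; apply/negP => h.
  have [| | |d dD [l []]] := away i i; rewrite ?leqnn ?eqxx ?addn2 //.
  by rewrite -eqn_leq ai eq_sym => ->.
have [| | |d' d'D [l' [h' nl' dl']]] := away i i.+1; rewrite ?leqnn ?leqnSn //.
  by rewrite ltn_eqF.
have [| | |d dD [l [h nl dl]]] := away i.-1 i; rewrite ?leqnn ?leq_pred //.
  by rewrite prednK // ltn_eqF // prednK.
have {h' nl'}el' : l' = i.+1 by move: h' nl'; rewrite ai; clear; lia.
have {h nl}el : l.+1 = i by move: h nl; rewrite ai; clear -i0; lia.
rewrite (pos_move m).
have [jd' [id' md']] := atom_move (DAP _ d'D); rewrite (raised_move md') el' in dl'.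
have [jd [id md]] := atom_move (DAP _ dD); rewrite (raised_move md) in dl.
have [e1 e2] := move_unwalled md' dl' (or_introl nw1).
have [|e3 e4] := move_unwalled md dl; first by rewrite el; right.
subst id' jd' id jd; rewrite el in md; have e3 : l = i.-1 by rewrite -el.
split; last first.
  by exists d, d'; rewrite (pos_move md) (pos_move md').
apply/specialP; exists i, d, d'; split; last by rewrite -e3.
by split=> //; apply: DAP.
Qed.

Local Notation N := #|A|.
Local Notation atom_at := (@atom_at _ _ _ bl).
Local Notation special_run := (special_run bl).

(** * The list of atoms *)

Lemma pos_le_raised a k : a \in A -> raised a k -> pos a <= k.
Proof.
case/atom_move=> j [i m]; rewrite (pos_move m) (raised_move m).
by case/andP.
Qed.

Lemma raised_convex a k l : a \in A -> raised a k -> pos a <= l <= k -> raised a l.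
Proof.
case/atom_move=> j [i m]; rewrite (pos_move m) !(raised_move m).
by case/andP=> _ kj /andP[-> lk]; apply: leq_ltn_trans kj.
Qed.

Lemma mem_critical a (k : 'I_n.+1) : (k \in critical beta (val a)) = raised a k.
Proof. by rewrite inE /raised ltn_neqAle itv_ge andbT eq_sym. Qed.

Lemma pos_lt a : a \in A -> pos a < n.+1.
Proof.
case/atom_move=> j [i m]; rewrite (pos_move m).
have [_ ij jr] := move_bounds m.
by rewrite ltnS (leq_trans (ltnW ij)) // (leq_trans jr) // plength_le.
Qed.

(** As the critical intervals are disjoint, the relation that sorts the list
    compares their left ends. *)
Lemma left_of_pos : {in A &, forall a c,
  ((a == c) || left_of a c) = (pos a <= pos c)}.
Proof.
move=> a c aA cA; have [->|ac] /= := eqVneq a c; first by rewrite leqnn.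
have pac : pos a != pos c by apply: contra ac => /eqP /pos_inj ->.
apply/forall_inP/idP => [h|le k].
  apply: ltnW.
  have /h/forall_inP/(_ (Ordinal (pos_lt cA))) :
      Ordinal (pos_lt aA) \in critical beta (val a).
    by rewrite mem_critical raised_pos.
  by apply; rewrite mem_critical raised_pos.
rewrite mem_critical => ak; apply/forall_inP => l; rewrite mem_critical => cl.
rewrite ltnNge; apply: contra ac => lk; apply/eqP.
apply: (raised_inj aA cA _ cl); apply: (raised_convex aA ak).
by rewrite lk andbT (leq_trans le) // pos_le_raised.
Qed.

Lemma mem_atom_list : atom_list bl =i A.
Proof. by move=> a; rewrite mem_sort mem_enum. Qed.

Lemma size_atom_list : size (atom_list bl) = N.
Proof. by rewrite size_sort -cardE. Qed.

Lemma sorted_pos : sorted ltn (map pos (atom_list bl)).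
Proof.
rewrite ltn_sorted_uniq_leq; apply/andP; split.
  rewrite map_inj_in_uniq ?sort_uniq ?enum_uniq // => a c.
  by rewrite !mem_atom_list; apply: pos_inj.
have inA : all (mem A) (enum A) by apply/allP => a; rewrite mem_enum.
have inAs : all (mem A) (atom_list bl).
  by apply/allP => a; rewrite mem_atom_list.
rewrite sorted_map; apply: sub_in_sorted inAs (sort_sorted_in _ inA).
  by move=> a c aA cA; rewrite left_of_pos.
by move=> a c aA cA; rewrite /= (left_of_pos aA cA) (left_of_pos cA aA) leq_total.
Qed.

Lemma mem_atom_at k : (atom_at k \in A) = (0 < k <= N).
Proof.
case: k => [|k]; first by rewrite inE ltxx.
rewrite /atom_at /= -size_atom_list; have [kN|Nk] := ltnP k (size (atom_list bl)).
  by rewrite -mem_atom_list mem_nth.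
by rewrite nth_default // inE ltxx.
Qed.

Lemma atom_at_ex a : a \in A -> exists k, a = atom_at k.
Proof.
rewrite -mem_atom_list => aA; exists (index a (atom_list bl)).+1.
by rewrite /atom_at /= nth_index.
Qed.

Lemma pos_atom_at k l : 0 < k -> k < l -> l <= N -> pos (atom_at k) < pos (atom_at l).
Proof.
case: k l => // k [|l] // _ kl lN; rewrite -size_atom_list in lN.
have kN : k < size (atom_list bl) by apply: leq_trans lN; apply: ltnW.
have := sorted_ltn_nth ltn_trans 0 sorted_pos.
move/(_ k l); rewrite !inE size_map kN lN => /(_ isT isT kl).
by rewrite !(nth_map \bot%O).
Qed.

Lemma atom_at_inj k l : atom_at k \in A -> atom_at k = atom_at l -> k = l.
Proof.
move=> kA e; have lA := kA; rewrite e in lA.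
move: kA lA; rewrite !mem_atom_at => /andP[k0 kN] /andP[l0 lN].
case: (ltngtP k l) => // [kl|lk].
  by have := pos_atom_at k0 kl lN; rewrite e ltnn.
by have := pos_atom_at l0 lk kN; rewrite e ltnn.
Qed.

Lemma atom_at_succ k c :
  atom_at k \in A -> c \in A -> pos c = (pos (atom_at k)).+1 -> c = atom_at k.+1.
Proof.
move=> kA cA; have [l cl] := atom_at_ex cA; rewrite {c}cl in cA *.
move: kA cA; rewrite !mem_atom_at => /andP[k0 kN] /andP[l0 lN] e.
have [lk|kl|lk] := ltngtP l k.
- by have := pos_atom_at l0 lk kN; rewrite e ltnNge leqnSn.
- have [->//|kl'] := eqVneq l k.+1; have {}kl' : k.+1 < l by rewrite ltn_neqAle eq_sym kl'.
  have := pos_atom_at (ltn0Sn k) kl' lN; rewrite e ltnS leqNgt.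
  by rewrite pos_atom_at // (leq_trans kl).
- by move/eqP: e; rewrite lk ltn_eqF.
Qed.

Lemma atom_at_pred k c :
  atom_at k \in A -> c \in A -> (pos c).+1 = pos (atom_at k) -> c = atom_at k.-1.
Proof.
move=> kA cA; have [l cl] := atom_at_ex cA; rewrite {c}cl in cA * => pc.
by have /(atom_at_inj kA) -> := atom_at_succ cA kA (esym pc).
Qed.

(** The neighbours of a special atom in the list are the two atoms that make
    it special, because their critical intervals are adjacent to its own. *)
Lemma special_at_nbrs k : special (atom_at k) ->
  [/\ atom_at k.-1 \in A, atom_at k.+1 \in A,
      (pos (atom_at k.-1)).+1 = pos (atom_at k) &
      pos (atom_at k.+1) = (pos (atom_at k)).+1].
Proof.
move=> sk; have kA := special_atom sk.
have [c [c' [cA c'A pc pc']]] := special_nbrs sk.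
by rewrite -(atom_at_succ kA c'A pc') -(atom_at_pred kA cA pc).
Qed.

Lemma le_join_at D k : D \subset A -> atom_at k \in A ->
  (atom_at k <= \join_(d in D) d)%O <->
  atom_at k \in D \/
  [/\ special (atom_at k), atom_at k.-1 \in D & atom_at k.+1 \in D].
Proof.
move=> DA kA; have /subsetP DAP := DA; split => [le|[kD|[sk k1 k2]]].
- have [kD|[sk [c [c' [cD c'D pc pc']]]]] := le_join_inv DA kA le; [by left|right].
  by rewrite -(atom_at_succ kA (DAP _ c'D) pc') -(atom_at_pred kA (DAP _ cD) pc).
- exact: joins_sup.
by have [_ _ pc pc'] := special_at_nbrs sk; apply: le_join_nbrs k1 k2 sk pc pc'.
Qed.

(** * Special runs *)

Lemma special_at_range k : special (atom_at k) -> 0 < k <= N.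
Proof. by move/special_atom; rewrite mem_atom_at. Qed.

Lemma special_runP m q :
  reflect [/\ 0 < q, forall i, 0 < i <= q -> special (atom_at (m + i)),
              ~~ special (atom_at m) & ~~ special (atom_at (m + q.+1))]
          (special_run m q).
Proof.
apply: (iffP and4P) => -[q0 h h0 h1]; split => //.
  by move=> i iq; apply: (allP h); rewrite mem_iota add1n ltnS.
by apply/allP => i; rewrite mem_iota add1n ltnS; apply: h.
Qed.

Lemma run_ex k : special (atom_at k) ->
  exists m q, special_run m q /\ exists2 i, 0 < i <= q & k = m + i.
Proof.
move=> sk.
have n0 : ~~ special (atom_at 0) by apply/negP => /special_at_range.
have exm : exists m, (m < k) && ~~ special (atom_at m).
  by exists 0; rewrite n0 andbT; case/andP: (special_at_range sk).
have exe : exists e, (k < e) && ~~ special (atom_at e).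
  exists N.+1; have /andP[_] := special_at_range sk; rewrite ltnS => -> /=.
  by apply/negP => /special_at_range; rewrite ltnn andbF.
have ub m : (m < k) && ~~ special (atom_at m) -> m <= k by case/andP=> /ltnW.
case: (ex_maxnP exm ub) => m /andP[mk nm] mm.
case: (ex_minnP exe) => e /andP[ke ne] me.
exists m, (e - m).-1; split; last by exists (k - m); lia.
apply/special_runP; split=> //; first by lia.
  move=> i hi; apply: contraT => ns.
  have := mm (m + i); have := me (m + i); rewrite ns !andbT.
  have : m + i != k by apply: contraNneq ns => ->.
  by lia.
by have -> : m + (e - m).-1.+1 = e by lia.
Qed.

(** Runs are maximal, so a special atom determines its run and its index in
    it.  The index [i] may be [0] or [q.+1] because the elements that surround
    a run also occur in the order relation; they are not special, hence belong
    to no run. *)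
Lemma run_uniq m q m' q' i i' :
    special_run m q -> special_run m' q' -> i <= q.+1 -> 0 < i' <= q' ->
    atom_at (m + i) = atom_at (m' + i') ->
  [/\ m = m', q = q' & i = i'].
Proof.
move=> /special_runP[q0 h h0 h1] /special_runP[q0' h' h0' h1'] iq iq' e.
have s := h' _ iq'; have sA := special_atom s.
have {}e := atom_at_inj sA (esym e).
have i0 : i != 0 by apply: contraNneq h0 => i0; rewrite -(addn0 m) -i0 -e.
have i1 : i != q.+1 by apply: contraNneq h1 => i1; rewrite -i1 -e.
have em : m = m'.
  case: (ltngtP m m') => // lt.
    have := h (m' - m); rewrite subnKC ?(ltnW lt) // (negPf h0'); lia.
  have := h' (m - m'); rewrite subnKC ?(ltnW lt) // (negPf h0); lia.
subst m'; have {e} ei : i = i' by lia.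
split=> //; case: (ltngtP q q') => // lt.
  by have := h' q.+1; rewrite (negPf h1); lia.
by have := h q'.+1; rewrite (negPf h1'); lia.
Qed.

Lemma run_range m q : special_run m q -> m + q <= N.
Proof.
case/special_runP=> q0 h _ _.
have /special_at_range/andP[] // : special (atom_at (m + q)).
by apply: h; rewrite q0 leqnn.
Qed.

Lemma run_at_atom m q i : special_run m q -> i <= q.+1 -> atom_at (m + i) \in A.
Proof.
case/special_runP=> q0 h _ _ iq.
have [i0|i0] := posnP i.
  by have [] := special_at_nbrs (h 1 ltac:(lia)); rewrite addn1 i0 addn0.
have [i1|i1] := eqVneq i q.+1.
  by have [] := special_at_nbrs (h q ltac:(lia)); rewrite i1 addnS.
by apply/special_atom/h; lia.
Qed.

Lemma run_ltP a c :
  reflect (exists m q i, [/\ special_run m q, 3 * i + 1 <= q,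
     a = atom_at (m + (3 * i + 1)) &
     c = atom_at (m + 3 * i) \/ c = atom_at (m + (3 * i + 2))])
   (run_lt bl a c).
Proof.
apply: (iffP existsP).
  case=> m /existsP[q /existsP[i /and4P[r iq /eqP ea /orP ec]]].
  by exists m, q, i; split=> //; case: ec => /eqP; [left|right].
case=> m [q [i [r iq ea ec]]]; have mq := run_range r.
have mN : m < N.+1 by lia.
have qN : q < N.+1 by lia.
have iN : i < N.+1 by lia.
exists (Ordinal mN); apply/existsP; exists (Ordinal qN).
apply/existsP; exists (Ordinal iN); rewrite /= r iq -ea eqxx /=.
by case: ec => ->; rewrite eqxx ?orbT.
Qed.

Lemma run_classP j a :
  reflect (exists m q i, [/\ special_run m q, 0 < 3 * i + j <= q &
     a = atom_at (m + (3 * i + j))])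
   (a \in run_class bl j).
Proof.
rewrite inE; apply: (iffP existsP).
  case=> m /existsP[q /existsP[i /and3P[r iq /eqP ea]]].
  by exists m, q, i.
case=> m [q [i [r iq ea]]]; have mq := run_range r.
have mN : m < N.+1 by lia.
have qN : q < N.+1 by lia.
have iN : i < N.+1 by lia.
exists (Ordinal mN); apply/existsP; exists (Ordinal qN).
by apply/existsP; exists (Ordinal iN); rewrite /= r iq -ea eqxx.
Qed.

(** Indices 0 and 2 modulo 3 are not 1 modulo 3, and the atoms around a run are
    in no run: the upper element of a strict relation is never a lower one. *)
Lemma run_lt_minimal a c c' : run_lt bl a c -> run_lt bl c c' -> False.
Proof.
move=> /run_ltP[m [q [i [r iq _ ec]]]] /run_ltP[m' [q' [i' [r' iq' ec' _]]]].
have [e|e] : c = atom_at (m + 3 * i) \/ c = atom_at (m + (3 * i + 2)) by [].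
  by have [||_ _] := run_uniq r r' _ _ (etrans (esym e) ec'); clear -iq iq'; lia.
by have [||_ _] := run_uniq r r' _ _ (etrans (esym e) ec'); clear -iq iq'; lia.
Qed.

Lemma tlt_run_le a c : tlt (run_le bl) a c = run_lt bl a c.
Proof.
rewrite /tlt /run_le /=; have [->|//] := eqVneq a c.
by apply/esym/negbTE/negP => h; case: (run_lt_minimal h h).
Qed.

Lemma atom_le_eq a c : a \in A -> c \in A -> (a <= c)%O -> a = c.
Proof.
move=> aA cA ac; apply: (raised_inj aA cA (raised_pos aA)).
exact: raised_le ac (raised_pos aA).
Qed.

(** * Bounded below sets and bases *)

Lemma pair_bounded_below m q i :
    special_run m q -> 3 * i + 1 <= q ->
  bounded_below (run_le bl) [set atom_at (m + 3 * i); atom_at (m + (3 * i + 2))].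
Proof.
move=> r iq; set D2 := [set _; _].
have xA : atom_at (m + 3 * i) \in A by apply: run_at_atom r _; lia.
have yA : atom_at (m + (3 * i + 2)) \in A by apply: run_at_atom r _; lia.
have sS : special (atom_at (m + (3 * i + 1))).
  by have /special_runP[_ h _ _] := r; apply: h; lia.
have sA := special_atom sS.
have xD : atom_at (m + 3 * i) \in D2 by rewrite set21.
have yD : atom_at (m + (3 * i + 2)) \in D2 by rewrite set22.
have DA : D2 \subset A by apply/subsetP => d /set2P[] ->.
have le : (atom_at (m + (3 * i + 1)) <= \join_(d in D2) d)%O.
  apply/(le_join_at DA sA); right; split=> //.
    by rewrite addn1 addnS.
  by rewrite -addnS -addnS.
have lt : (atom_at (m + (3 * i + 1)) < \join_(d in D2) d)%O.
  rewrite lt_neqAle le andbT; apply/eqP => e.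
  have : (atom_at (m + 3 * i) <= atom_at (m + (3 * i + 1)))%O.
    by rewrite e; apply: joins_sup.
  move/(atom_le_eq xA sA)/(atom_at_inj xA)/eqP.
  by rewrite eqn_add2l addn1 ltn_eqF.
apply/and3P; split=> //; first by apply/set0Pn; exists (atom_at (m + 3 * i)).
apply/forall_inP => d dD; apply/exists_inP; exists (atom_at (m + (3 * i + 1))) => //.
rewrite tlt_run_le lt andbT; apply/run_ltP; exists m, q, i; split => //.
by case/set2P: dD; [left|right].
Qed.

(** Let [a] be the atom that is strictly below some member of [D] and below the
    join.  It is not in [D], since nothing is strictly below it in turn; so it
    is forced by its two neighbours. *)
Lemma bounded_below_pair D : bounded_below (run_le bl) D ->
  exists m q i, [/\ special_run m q, 3 * i + 1 <= q,
    atom_at (m + 3 * i) \in D & atom_at (m + (3 * i + 2)) \in D].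
Proof.
case/and3P => /set0Pn[d dD] DA /forall_inP h.
have /exists_inP[a aA /andP[ad aJ]] := h d dD; rewrite tlt_run_le in ad.
have [m [q [i [r iq ea _]]]] := run_ltP _ _ ad.
rewrite {}ea in aA aJ ad; exists m, q, i.
have [sD|[_ xD yD]] := (le_join_at DA aA).1 (ltW aJ).
  have /exists_inP[b bA /andP[ba _]] := h _ sD; rewrite tlt_run_le in ba.
  by case: (run_lt_minimal ba ad).
rewrite addn1 addnS /= in xD; split=> //.
by rewrite -addnS -addnS in yD.
Qed.

Lemma nbb_pairs B : B \subset A ->
  nbb (run_le bl) B <-> forall m q i, special_run m q -> 3 * i + 1 <= q ->
    atom_at (m + 3 * i) \in B -> atom_at (m + (3 * i + 2)) \notin B.
Proof.
move=> BA; split=> [/andP[_ /forallP h] m q i r iq xB|h].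
  apply/negP => yB; have /implyP/(_ _)/negP :=
    h [set atom_at (m + 3 * i); atom_at (m + (3 * i + 2))].
  apply; last exact: pair_bounded_below r iq.
  by apply/subsetP => d /set2P[] ->.
rewrite /nbb BA; apply/forallP => D; apply/implyP => /subsetP DB.
apply/negP => /bounded_below_pair[m [q [i [r iq xD yD]]]].
by have := h m q i r iq (DB _ xD); rewrite DB.
Qed.

Lemma join_top_at B :
    (\join_(a in A) a)%O = itv_top bl -> B \subset A ->
  (\join_(a in B) a)%O = itv_top bl <->
  forall k, atom_at k \in A -> atom_at k \in B \/
    [/\ special (atom_at k), atom_at k.-1 \in B & atom_at k.+1 \in B].
Proof.
move=> joinA BA; split=> [e k kA|h].
  by apply/(le_join_at BA kA); rewrite e; apply: lex1.
apply/le_anti; rewrite -{2}joinA (le_trans (lex1 _)) //=.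
apply/joinsP => a aA; have [k ak] := atom_at_ex aA; rewrite {a}ak in aA *.
exact/(le_join_at BA aA)/h.
Qed.

(** The propagation along a run: each element of index 0 modulo 3 in the base
    determines the next three elements. *)
Lemma base_on_run m q B i :
    nbb_base (run_le bl) B (itv_top bl) ->
    (\join_(a in A) a)%O = itv_top bl -> special_run m q ->
    (3 * i <= q -> atom_at (m + 3 * i) \in B) /\
    (3 * i + 1 <= q -> [/\ atom_at (m + (3 * i + 1)) \in B,
       3 * i + 2 <= q & atom_at (m + (3 * i + 2)) \notin B]).
Proof.
case/andP=> nB /eqP jB joinA r; have /andP[BA _] := nB.
have pairs := (nbb_pairs BA).1 nB _ _ _ r.
have cl := (join_top_at joinA BA).1 jB.
have inA k : k <= q.+1 -> atom_at (m + k) \in A by apply: run_at_atom.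
have /special_runP[q0 sp s0 s1] := r.
have step k : atom_at (m + 3 * k) \in B -> 3 * k + 1 <= q ->
    [/\ atom_at (m + (3 * k + 1)) \in B, 3 * k + 2 <= q,
       atom_at (m + (3 * k + 2)) \notin B & atom_at (m + 3 * k.+1) \in B].
  move=> xB kq; have yB := pairs k kq xB.
  have zA : atom_at (m + (3 * k + 1)) \in A by apply/inA/leqW.
  have yA : atom_at (m + (3 * k + 2)) \in A by apply: inA; rewrite addnS ltnS.
  (* sigma_{3k+1} cannot be forced by its neighbours: yB excludes the right one. *)
  have [zB|[_ _]] := cl _ zA; last by rewrite -addnS -addnS (negPf yB).
  (* sigma_{3k+2} must be forced, hence special and followed by a member of B. *)
  have [|[sy _ wB]] := cl _ yA; first by rewrite (negPf yB).
  split=> //; last first.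
    by have -> : m + 3 * k.+1 = (m + (3 * k + 2)).+1 by clear; lia.
  rewrite leqNgt; apply/negP => lt; case/negP: s1.
  suff -> : q.+1 = 3 * k + 2 by [].
  by apply/eqP; rewrite eqn_leq lt addn2 -addn1 ltnS kq.
have main : 3 * i <= q -> atom_at (m + 3 * i) \in B.
  elim: i => [|k IH] kq.
    rewrite muln0 addn0; have [|//|[]] := cl m; last by rewrite (negPf s0).
    by have := inA 0; rewrite addn0; apply.
  have k1 : 3 * k + 1 <= q by rewrite (leq_trans _ kq) // mulnS addnC leq_add2r.
  by have [] := step k (IH (leq_trans (leq_addr _ _) k1)) k1.
split=> // kq; have iq := leq_trans (leq_addr 1 _) kq.
by have [] := step i (main iq) kq.
Qed.

End Atoms.

Theorem theorem5p1 (n : nat) (beta lambda : intpart n)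
    (bl : (beta <= lambda)%O)
    (joinA : (\join_(a in atoms (itv_lattice bl)) a)%O = itv_top bl) :
  ((exists B : {set itv_lattice bl}, nbb_base (run_le bl) B (itv_top bl)) <->
   ~ (exists m q : nat, special_run bl m q /\ q = 1 %[mod 3])) /\
  (forall B : {set itv_lattice bl}, nbb_base (run_le bl) B (itv_top bl) ->
     B = atoms (itv_lattice bl) :\: run_class bl 2).
Proof.
have div3 r : r = 3 * (r %/ 3) + r %% 3 by rewrite mulnC -divn_eq.
split; last first.
  move=> B base; have /andP[nB /eqP jB] := base; have /andP[BA _] := nB.
  apply/setP => a; rewrite inE; apply/idP/andP => [aB|[a2 aA]].
    split; last exact: (subsetP BA).
    apply/run_classP => -[m [q [i [r iq ea]]]].
    have [_ /(_ ltac:(lia))[_ _]] := base_on_run i base joinA r.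
    by rewrite -ea aB.
  have [k ak] := atom_at_ex aA; rewrite {a}ak in aA a2 *.
  have [//|[sk _ _]] := (join_top_at joinA BA).1 jB k aA.
  have [m [q [r [s sq ek]]]] := run_ex sk; rewrite {k}ek in sk a2 aA *.
  have [b0 b1] := base_on_run (s %/ 3) base joinA r.
  have := ltn_pmod s (isT : 0 < 3); have := div3 s.
  case: (s %% 3) => [|[|[|//]]] es _.
  - by move: b0; rewrite -(addn0 (3 * _)) -es; apply; case/andP: sq.
  - by move: b1; rewrite -es => -[] //; case/andP: sq.
  - by case/run_classP: a2; exists m, q, (s %/ 3); rewrite -es.
split=> [[B base] [m [q [r e]]]|norun].
  have [_ h] := base_on_run (q %/ 3) base joinA r.
  by have := div3 q; rewrite e /= => eq; case: h; lia.
exists (atoms (itv_lattice bl) :\: run_class bl 2).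
set B := _ :\: _; have BA : B \subset atoms (itv_lattice bl) by apply: subsetDl.
apply/andP; split; last first.
  apply/eqP/(join_top_at joinA BA) => k kA.
  rewrite [atom_at bl k \in B]inE kA andbT.
  have [k2|] := boolP (_ \in _); [right|by left].
  have /run_classP[m [q [i [r iq ek]]]] := k2.
  have {}ek := atom_at_inj kA ek; rewrite {k}ek in k2 kA *.
  (* The neighbours of sigma_{3i+2} may be elements of the run or the atom after
     it; in each case they are in B. *)
  have other s : s <= q.+1 -> s != 3 * i + 2 %[mod 3] -> atom_at bl (m + s) \in B.
    move=> sq ns; rewrite inE (run_at_atom r sq) andbT.
    apply/run_classP => -[m' [q' [i' [r' iq' e]]]].
    have [_ _ es] := run_uniq r r' sq iq' e.
    by move: ns; rewrite es !(mulnC 3) !modnMDl eqxx.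
  split.
  - by have /special_runP[_ h _ _] := r; apply: h.
  - have -> : (m + (3 * i + 2)).-1 = m + (3 * i + 1) by clear; lia.
    by apply: other; [clear -iq; lia|rewrite mulnC !modnMDl].
  - have -> : (m + (3 * i + 2)).+1 = m + (3 * i + 3) by clear; lia.
    by apply: other; [clear -iq; lia|rewrite mulnC !modnMDl].
apply/(nbb_pairs BA) => m q i r iq _; rewrite inE negb_and negbK.
apply/orP; left; apply/run_classP; exists m, q, i; split => //.
have [e|] := eqVneq q (3 * i + 1); last by lia.
by case: norun; exists m, q; rewrite r e mulnC modnMDl.
Qed.
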